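(* Consider one step of the PSD-id method for the $i$th eigenpair of $(H,S)$, from $(\lambda_{i;j},u_{i;j})$ to $(\lambda_{i;j+1},u_{i;j+1})$, with a Hermitian, effectively positive definite preconditioner $K_{i;j}$. Let $\epsilon_{i;j}=\lambda_{i;j}-\lambda_i$ and $\epsilon_{i;j+1}=\lambda_{i;j+1}-\lambda_i$. Let $P_{i-1}=I-U_{i-1}U_{i-1}^HS$, $M=P_{i-1}^H(H-\lambda_iS)P_{i-1}$, and $$\theta_{i;j}=\|S^{1/2}K_{i;j}MK_{i;j}S^{1/2}\|,\quad \delta_{i;j}=\|S^{1/2}K_{i;j}S^{1/2}\|,\quad \Delta=\frac{\Gamma-\gamma}{\Gamma+\gamma},\quad \tau=\frac{2}{\Gamma+\gamma},$$ where $\Gamma$ and $\gamma$ are the largest and the smallest positive eigenvalues of $K_{i;j}M$, respectively. If $\lambda_{i;j}$ is localized, namely $$\tau\big(\sqrt{\theta_{i;j}\epsilon_{i;j}}+\delta_{i;j}\epsilon_{i;j}\big)<1,$$ then $$\epsilon_{i;j+1}\le\left[\frac{\Delta+\tau\sqrt{\theta_{i;j}\epsilon_{i;j}}}{1-\tau\big(\sqrt{\theta_{i;j}\epsilon_{i;j}}+\delta_{i;j}\epsilon_{i;j}\big)}\right]^2\epsilon_{i;j}.$$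
   Context: $H,S\in\mathbb{C}^{n\times n}$ are Hermitian and $S$ is positive definite. The eigenpairs of $Hu=\lambda Su$ are $(\lambda_k,u_k)$, $k=1,\dots,n$, with $\lambda_1\le\cdots\le\lambda_n$ and $U=[u_1\ \cdots\ u_n]$ satisfying $U^HSU=I$. Write $U_{i-1}=[u_1\ \cdots\ u_{i-1}]$ (empty if $i=1$) and $U_{i-1}^c=[u_i\ \cdots\ u_n]$. The index $i$ is fixed with $1\le i\le n-1$, and it is assumed that $\lambda_{i-1}<\lambda_i<\lambda_{i+1}$ (the first inequality is void if $i=1$). The Rayleigh quotient is $\rho(z)=z^HHz/(z^HSz)$; $\|x\|_S=\sqrt{x^HSx}$; $\|\cdot\|$ is the spectral norm for matrices. One step of the PSD-id method (preconditioned steepest descent with implicit deflation): given $u_{i;j}$ with $U_{i-1}^HSu_{i;j}=0$, $\|u_{i;j}\|_S=1$ and $\lambda_{i;j}=\rho(u_{i;j})$, compute $r_{i;j}=Hu_{i;j}-\lambda_{i;j}Su_{i;j}$ and $p_{i;j}=-K_{i;j}r_{i;j}$, where $K_{i;j}\in\mathbb{C}^{n\times n}$ is a preconditioner; set $Z_j=[U_{i-1}\ u_{i;j}\ p_{i;j}]$, which is assumed to have full column rank; let $(\gamma_i,w_i)$ be the $i$th eigenpair (eigenvalues in ascending order) of $(H_R,S_R)=(Z_j^HHZ_j,Z_j^HSZ_j)$ with $w_i^HS_Rw_i=1$; set $\lambda_{i;j+1}=\gamma_i$ and $u_{i;j+1}=Z_jw_i$. $K_{i;j}$ is called effectively positive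 definite if $K^c_{i;j}=(U_{i-1}^c)^HSK_{i;j}SU_{i-1}^c$ is Hermitian positive definite. *)

(* Defs.v *)
From HB Require Import structures.
From mathcomp Require Import all_boot all_order all_algebra.
From mathcomp Require Import boolp classical_sets reals.
From mathcomp Require Import complex.
Set Implicit Arguments.
Unset Strict Implicit.
Unset Printing Implicit Defensive.
Import Order.TTheory GRing.Theory Num.Theory.
Local Open Scope ring_scope.
Local Open Scope sesquilinear_scope.
Local Open Scope complex_scope.

Section PositiveDefinite.
Variable R : realType.
Local Notation C := R[i].

Definition hpdmx n (A : 'M[C]_n) : Prop :=
  A \is hermsymmx /\
  forall x : 'cV[C]_n, x != 0 -> 0 < (x^t* *m A *m x) 0 0.

(* A^{1/2}, by functional calculus on the spectral decomposition. *)
Definition sqrtmx n (A : 'M[C]_n) : 'M[C]_n :=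
  (spectralmx A)^t* *m diag_mx (map_mx sqrtC (spectral_diag A))
    *m spectralmx A.

(* ||x||_S; with S = 1%:M this is the Euclidean norm. *)
Definition normS n (S : 'M[C]_n) (x : 'cV[C]_n) : R :=
  Num.sqrt (complex.Re ((x^t* *m S *m x) 0 0)).

(* The norm induced by the Euclidean norms. *)
Definition specnorm m n (A : 'M[C]_(m, n)) : R :=
  sup [set normS 1%:M (A *m x) | x in
         [set x : 'cV[C]_n | normS 1%:M x <= 1]]%classic.

Definition rayleigh n (H S : 'M[C]_n) (z : 'cV[C]_n) : C :=
  (z^t* *m H *m z) 0 0 / (z^t* *m S *m z) 0 0.

End PositiveDefinite.

Section Eigenpairs.
Variable R : realType.
Local Notation C := R[i].

(* The columns of U are B-orthonormal eigenvectors of A u = l B u, listed with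
   multiplicity by ascending eigenvalue. *)
Definition eigensystem n (A B : 'M[C]_n) (l : 'I_n -> R) (U : 'M[C]_n) : Prop :=
  [/\ forall k, A *m col k U = (l k)%:C *: (B *m col k U),
      U^t* *m B *m U = 1%:M
    & forall j k : 'I_n, (j <= k)%N -> l j <= l k].

(* (g, w) is the k-th eigenpair of (A, B), w being normalized; k counts from 0.
   When the k-th eigenvalue is multiple, w is any admissible choice. *)
Definition kth_eigenpair n (A B : 'M[C]_n) (k : 'I_n) (g : R) (w : 'cV[C]_n) :
    Prop :=
  exists l W, [/\ eigensystem A B l W, g = l k & w = col k W].

(* [eigenvalue] is about row eigenvectors; a square matrix has the same
   eigenvalues on either side. *)
Definition max_pos_eigenvalue n (A : 'M[C]_n) (a : R) : Prop :=
  [/\ 0 < a, eigenvalue A a%:C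
    & forall b : R, 0 < b -> eigenvalue A b%:C -> b <= a].

Definition min_pos_eigenvalue n (A : 'M[C]_n) (a : R) : Prop :=
  [/\ 0 < a, eigenvalue A a%:C
    & forall b : R, 0 < b -> eigenvalue A b%:C -> a <= b].

End Eigenpairs.

Section Deflation.
Variables (R : realType) (n : nat).
Local Notation C := R[i].

(* Indices count from 0, so i : 'I_n has exactly i predecessors: the textbook
   [u_1 ... u_(i-1)] is [headcols U i] and [u_i ... u_n] is [tailcols U i]. *)
Definition headcols (U : 'M[C]_n) (i : 'I_n) : 'M[C]_(n, i) :=
  colsub (widen_ord (ltnW (ltn_ord i))) U.

Definition tailcols (U : 'M[C]_n) (i : 'I_n) : 'M[C]_(n, n - i) :=
  colsub (fun b => cast_ord (subnKC (ltnW (ltn_ord i))) (rshift i b)) U.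

Definition eff_posdef (S U : 'M[C]_n) (i : 'I_n) (K : 'M[C]_n) : Prop :=
  hpdmx ((tailcols U i)^t* *m S *m K *m S *m tailcols U i).

(* Z = [V u p] with p = - K r and r = H u - l S u. *)
Definition psd_basis m (H S : 'M[C]_n) (V : 'M[C]_(n, m)) (K : 'M[C]_n)
    (l : R) (u : 'cV[C]_n) : 'M[C]_(n, m + 1 + 1) :=
  let r := H *m u - l%:C *: (S *m u) in
  let p := - (K *m r) in
  row_mx (row_mx V u) p.

(* One step (l, u) -> (l', u') for the eigenpair of (H, S) preceded by the m
   deflated eigenvectors V. The index [lshift 1 (rshift m ord0)] has value m. *)
Definition psd_id_step m (H S : 'M[C]_n) (V : 'M[C]_(n, m)) (K : 'M[C]_n)
    (l : R) (u : 'cV[C]_n) (l' : R) (u' : 'cV[C]_n) : Prop :=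
  let Z := psd_basis H S V K l u in
  [/\ V^t* *m S *m u = 0,
      normS S u = 1,
      l%:C = rayleigh H S u,
      \rank Z = (m + 1 + 1)%N
    & exists2 w, kth_eigenpair (Z^t* *m H *m Z) (Z^t* *m S *m Z)
                   (lshift 1 (rshift m (@ord0 0))) l' w
               & u' = Z *m w].

End Deflation.

Section SquareRootFacts.
Variables (R : realType) (n : nat) (A : 'M[R[i]]_n).
Hypothesis hA : hpdmx A.
Let P := spectralmx A.
Let d := spectral_diag A.

Let PPt : P *m P^t* = 1%:M.
Proof. by apply/unitarymxP/spectral_unitarymx. Qed.

Let PtP : P^t* *m P = 1%:M.
Proof. exact: mulmx1C PPt. Qed.

Let AE : A = P^t* *m diag_mx d *m P.
Proof.
have /orthomx_spectralP := hermitian_normalmx hA.1.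
by rewrite invmx_unitary ?spectral_unitarymx.
Qed.

Let d_gt0 j : 0 < d 0 j.
Proof.
have x0 : P^t* *m delta_mx j (0 : 'I_1) != 0.
  apply/eqP => /(congr1 (mulmx P)); rewrite mulmxA PPt mul1mx mulmx0.
  by move/matrixP/(_ j 0)/eqP; rewrite !mxE !eqxx oner_eq0.
have := hA.2 _ x0; rewrite AE trmx_mul map_mxM trmxCK.
rewrite !mulmxA -(mulmxA _ P) PPt mulmx1 -(mulmxA _ P) PPt mulmx1.
have -> : (delta_mx j (0 : 'I_1))^t* = delta_mx 0 j :> 'M[R[i]]__.
  by rewrite trmx_delta map_delta_mx.
by rewrite -rowE -colE !mxE eqxx mulr1n.
Qed.

Lemma sqrtmxK : sqrtmx A *m sqrtmx A = A.
Proof.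
rewrite [RHS]AE /sqrtmx -/P -/d !mulmxA -(mulmxA _ P) PPt mulmx1.
rewrite -(mulmxA _ (diag_mx _) (diag_mx _)) mulmx_diag.
congr (_ *m diag_mx _ *m _); apply/rowP => j.
by rewrite !mxE -expr2 sqrtCK.
Qed.

Lemma sqrtmx_hpd : hpdmx (sqrtmx A).
Proof.
split.
  apply/is_hermitianmxP; rewrite expr0 scale1r /sqrtmx -/P -/d.
  rewrite !trmx_mul !map_mxM trmxCK tr_diag_mx map_diag_mx mulmxA.
  congr (_ *m diag_mx _ *m _); apply/rowP => j; rewrite !mxE.
  by apply/esym/CrealP/ger0_real; rewrite sqrtC_ge0 ltW.
move=> x x0; pose y := P *m x.
have y0 : y != 0.
  apply: contraNneq x0 => y0.
  by rewrite -[x]mul1mx -PtP -mulmxA -/y y0 mulmx0.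
have -> : x^t* *m sqrtmx A *m x = y^t* *m diag_mx (map_mx sqrtC d) *m y.
  by rewrite /sqrtmx -/P -/d /y trmx_mul map_mxM !mulmxA.
clearbody y.
have [j yj] : exists j, y j 0 != 0.
  by case/matrix0Pn: y0 => j [k]; rewrite ord1; exists j.
have F k : y^t* 0 k * sqrtC (d 0 k) * y k 0 = sqrtC (d 0 k) * `|y k 0| ^+ 2.
  by rewrite normCK !mxE [X in X * _]mulrC -mulrA [X in _ * X]mulrC.
rewrite mul_mx_diag mxE; under eq_bigr => k _ do rewrite mxE [map_mx _ d _ _]mxE F.
rewrite (bigD1 j) //= ltr_wpDr //; last first.
  by rewrite mulr_gt0 ?sqrtC_gt0 // exprn_gt0 // normr_gt0.
by apply: sumr_ge0 => k _; rewrite mulr_ge0 ?sqrtC_ge0 ?exprn_ge0 // ltW.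
Qed.

End SquareRootFacts.

(* Main.v *)
Require Import Defs.
From HB Require Import structures.
From mathcomp Require Import all_boot all_order all_algebra.
From mathcomp Require Import boolp classical_sets reals.
From mathcomp Require Import complex.
From mathcomp Require Import ring.
Set Implicit Arguments.
Unset Strict Implicit.
Unset Printing Implicit Defensive.
Import Order.TTheory GRing.Theory Num.Theory.
Local Open Scope ring_scope.
Local Open Scope sesquilinear_scope.
Local Open Scope complex_scope.

(* In S-orthonormal eigenvector coordinates, deflation leaves the block of the
   trailing columns T, where K becomes k = T^H S K S T and H - lam_i S becomes a
   diagonal A >= 0. For the iterate u = T c with |c| = 1 and eps = c^H A c, take
   d = c - tau k (A c - eps c), so that T d lies in the search space. Split
   d = (c - tau k A c) + tau eps k c. The nonzero eigenvalues of k A lie in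
   [gam, Gam], so the first term has A-norm at most Delta sqrt(eps), and the second
   one at most tau eps sqrt(theta). Moreover |k A c| <= sqrt(theta eps) and
   |k c| <= delta bound |d| from below. Courant-Fischer applied to the span of the
   deflated eigenvectors and T d bounds the Ritz value by the Rayleigh quotient
   of T d. *)

(** * Real parts of sesquilinear forms, and seminorms of semidefinite matrices *)

Section RealForm.
Variable R : realType.
Local Notation C := R[i].

Lemma adjmxM m n p (A : 'M[C]_(m, n)) (B : 'M[C]_(n, p)) :
  (A *m B)^t* = B^t* *m A^t*.
Proof. by rewrite trmx_mul map_mxM. Qed.

Lemma adjmxD m n (A B : 'M[C]_(m, n)) : (A + B)^t* = A^t* + B^t*.
Proof. by rewrite linearD map_mxD. Qed.

Lemma adjmxN m n (A : 'M[C]_(m, n)) : (- A)^t* = - A^t*.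
Proof. by rewrite linearN map_mxN. Qed.

Lemma conj_realc (a : R) : (a%:C)^* = a%:C.
Proof. by rewrite conjc_real. Qed.

Lemma adjmxZ m n (a : R) (A : 'M[C]_(m, n)) : (a%:C *: A)^t* = a%:C *: A^t*.
Proof. by rewrite linearZ map_mxZ /=; congr (_ *: _); exact: conj_realc. Qed.

Lemma adjmx1 n : (1%:M : 'M[C]_n)^t* = 1%:M.
Proof. by rewrite trmx1 map_mx1. Qed.

Lemma hermsymmxP n (A : 'M[C]_n) : A \is hermsymmx <-> A^t* = A.
Proof.
split; first by move/is_hermitianmxP; rewrite expr0 scale1r.
by move=> AE; apply/is_hermitianmxP; rewrite expr0 scale1r AE.
Qed.

Lemma ReD (x y : C) : complex.Re (x + y) = complex.Re x + complex.Re y.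
Proof. by case: x; case: y. Qed.

Lemma ReN (x : C) : complex.Re (- x) = - complex.Re x.
Proof. by case: x. Qed.

Lemma ReZ (a : R) (x : C) : complex.Re (a%:C * x) = a * complex.Re x.
Proof. by case: x => x y /=; rewrite mul0r subr0. Qed.

Lemma Re_sum (I : finType) (P : pred I) (F : I -> C) :
  complex.Re (\sum_(j | P j) F j) = \sum_(j | P j) complex.Re (F j).
Proof. by apply: (big_morph _ ReD). Qed.

(** The real part keeps all estimates in the ordered field [R]: the form is real-bilinear, symmetric
    for Hermitian [A], and its diagonal is the square of [normS]. *)
Definition rform n (A : 'M[C]_n) (x y : 'cV[C]_n) : R :=
  complex.Re ((x^t* *m A *m y) 0 0).

Lemma normSE n (A : 'M[C]_n) x : normS A x = Num.sqrt (rform A x x).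
Proof. by []. Qed.

Lemma rformDl n (A : 'M[C]_n) x y z : rform A (x + y) z = rform A x z + rform A y z.
Proof. by rewrite /rform adjmxD !mulmxDl mxE ReD. Qed.

Lemma rformDr n (A : 'M[C]_n) x y z : rform A x (y + z) = rform A x y + rform A x z.
Proof. by rewrite /rform !mulmxDr mxE ReD. Qed.

Lemma rformNl n (A : 'M[C]_n) x y : rform A (- x) y = - rform A x y.
Proof. by rewrite /rform adjmxN !mulNmx mxE ReN. Qed.

Lemma rformNr n (A : 'M[C]_n) x y : rform A x (- y) = - rform A x y.
Proof. by rewrite /rform !mulmxN mxE ReN. Qed.

Lemma rformZl n (A : 'M[C]_n) (a : R) x y :
  rform A (a%:C *: x) y = a * rform A x y.
Proof. by rewrite /rform adjmxZ -!scalemxAl mxE ReZ. Qed.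

Lemma rformZr n (A : 'M[C]_n) (a : R) x y :
  rform A x (a%:C *: y) = a * rform A x y.
Proof. by rewrite /rform -!scalemxAr mxE ReZ. Qed.

Lemma rformC n (A : 'M[C]_n) x y : A \is hermsymmx -> rform A x y = rform A y x.
Proof.
move=> /hermsymmxP AE; rewrite /rform.
have -> : x^t* *m A *m y = (y^t* *m A *m x)^t*.
  by rewrite !adjmxM trmxCK AE mulmxA.
by rewrite !mxE; case: (\sum_(_ < _) _).
Qed.

Lemma rformM n p (A : 'M[C]_n) (B : 'M[C]_(n, p)) (D : 'M[C]_(n, p)) x y :
  rform A (B *m x) (D *m y) = rform (B^t* *m A *m D) x y.
Proof. by rewrite /rform adjmxM !mulmxA. Qed.

Lemma rformMl n (A B : 'M[C]_n) x y :
  rform A (B *m x) y = rform (B^t* *m A) x y.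
Proof. by rewrite /rform adjmxM !mulmxA. Qed.

Lemma rformMr n (A B : 'M[C]_n) x y : rform A x (B *m y) = rform (A *m B) x y.
Proof. by rewrite /rform !mulmxA. Qed.

Lemma rform_addmx n (A B : 'M[C]_n) x y :
  rform (A + B) x y = rform A x y + rform B x y.
Proof. by rewrite /rform mulmxDr mulmxDl mxE ReD. Qed.

Lemma rform_oppmx n (A : 'M[C]_n) x y : rform (- A) x y = - rform A x y.
Proof. by rewrite /rform mulmxN mulNmx mxE ReN. Qed.

Lemma rform_scalemx n (a : R) (A : 'M[C]_n) x y :
  rform (a%:C *: A) x y = a * rform A x y.
Proof. by rewrite /rform -scalemxAr -scalemxAl mxE ReZ. Qed.

(** The modulus on [C] is itself valued in [C]; the real part moves its square to [R]. *)
Definition normsq (z : C) : R := complex.Re (`|z| ^+ 2).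

Lemma normsq_ge0 z : 0 <= normsq z.
Proof. by rewrite /normsq -add_Re2_Im2 /= addr_ge0 ?sqr_ge0. Qed.

Lemma normsq_gt0 z : z != 0 -> 0 < normsq z.
Proof.
move=> z0; have: 0 < `|z| ^+ 2 by rewrite exprn_gt0 ?normr_gt0.
by rewrite ltcE => /andP[].
Qed.

Lemma normsq0 : normsq 0 = 0.
Proof. by rewrite /normsq normr0 expr0n. Qed.

Lemma normsq1 : normsq 1 = 1.
Proof. by rewrite /normsq normr1 expr1n. Qed.

Lemma normsqZ (a : R) z : normsq (a%:C * z) = a ^+ 2 * normsq z.
Proof.
rewrite /normsq normrM exprMn.
have -> : `|a%:C| ^+ 2 = (a ^+ 2)%:C :> C by rewrite -add_Re2_Im2 /= expr0n addr0.
by rewrite ReZ.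
Qed.

Lemma rform_scale n (A : 'M[C]_n) (a : C) x :
  rform A (a *: x) (a *: x) = normsq a * rform A x x.
Proof.
have normsqE : (normsq a)%:C = a^* * a by rewrite -normCKC /normsq -add_Re2_Im2.
rewrite /rform (_ : (a *: x)^t* = a^* *: x^t*); last by rewrite linearZ map_mxZ.
by rewrite -!scalemxAl -scalemxAr scalerA mxE -normsqE ReZ.
Qed.

Lemma rform_diag n (d : 'I_n -> R) (x : 'cV[C]_n) :
  rform (diag_mx (\row_j (d j)%:C)) x x =
  \sum_j d j * normsq (x j 0).
Proof.
rewrite /rform mul_mx_diag mxE Re_sum; apply: eq_bigr => j _.
rewrite !mxE -ReZ normCK; congr complex.Re; rewrite mulrAC mulrA; ring.
Qed.

Lemma rform1 n (x : 'cV[C]_n) :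
  rform 1%:M x x = \sum_j normsq (x j 0).
Proof.
have -> : 1%:M = diag_mx (\row_(j < n) (1 : R)%:C).
  by apply/matrixP => j k; rewrite !mxE.
by rewrite rform_diag; under eq_bigr do rewrite mul1r.
Qed.

(** Semidefinite only: the shifted tail block has a zero diagonal entry at the wanted eigenvalue, so
    its [normS] is a seminorm. *)
Definition psdform n (A : 'M[C]_n) : Prop :=
  A \is hermsymmx /\ forall x, 0 <= rform A x x.

Lemma psdform1 n : psdform (1%:M : 'M[C]_n).
Proof.
split; first by apply/hermsymmxP; rewrite adjmx1.
by move=> x; rewrite rform1 sumr_ge0 // => j _; apply: normsq_ge0.
Qed.

Section Semidefinite.
Variables (n : nat) (A : 'M[C]_n).
Hypothesis hA : psdform A.

Lemma cauchy_schwarz_sqr x y :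
  rform A x y ^+ 2 <= rform A x x * rform A y y.
Proof.
have [herm ge0] := hA.
have Q t : 0 <= rform A x x + 2 * t * rform A x y + t ^+ 2 * rform A y y.
  have := ge0 (x + t%:C *: y).
  rewrite !(rformDl, rformDr, rformZl, rformZr) (rformC y x herm) => h.
  move: h; move: (rform A x x) (rform A x y) (rform A y y) => a b e h.
  by rewrite (_ : _ + _ = a + t * b + (t * b + t * (t * e))) //; ring.
move: (ge0 x) (ge0 y) Q; move: (rform A x x) (rform A x y) (rform A y y) => a b e.
move=> a0 e0 Q; have [{}e0|ne0] := eqVneq e 0.
  rewrite e0 mulr0; have [->|b0] := eqVneq b 0; first by rewrite expr0n.
  (* With [e = 0] the quadratic is affine in [t]; this [t] gives it the value -1. *)
  have := Q (- (a + 1) / (2 * b)); rewrite e0 mulr0 addr0.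
  have -> : a + 2 * (- (a + 1) / (2 * b)) * b = -1 by field.
  by rewrite ler0N1.
have ep : 0 < e by rewrite lt_def ne0.
(* The minimizer of the quadratic. *)
have := Q (- b / e).
have -> : a + 2 * (- b / e) * b + (- b / e) ^+ 2 * e = (a * e - b ^+ 2) / e by field.
by rewrite pmulr_lge0 ?invr_gt0 // subr_ge0.
Qed.

Lemma normS_ge0 x : 0 <= normS A x.
Proof. exact: sqrtr_ge0. Qed.

Lemma sqr_normS x : normS A x ^+ 2 = rform A x x.
Proof. by rewrite normSE sqr_sqrtr // hA.2. Qed.

Lemma cauchy_schwarz x y : rform A x y <= normS A x * normS A y.
Proof.
apply: le_trans (ler_norm _) _; rewrite -ler_sqr ?nnegrE ?mulr_ge0 ?normS_ge0 //.
by rewrite real_normK ?num_real // exprMn !sqr_normS cauchy_schwarz_sqr.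
Qed.

Lemma normSD x y : normS A (x + y) <= normS A x + normS A y.
Proof.
rewrite -ler_sqr ?nnegrE ?addr_ge0 ?normS_ge0 // sqrrD !sqr_normS.
rewrite !(rformDl, rformDr) (rformC y x hA.1) addrA lerD2r -addrA lerD2l.
by rewrite -mulr2n lerMn2r cauchy_schwarz orbT.
Qed.

Lemma normSZ (a : R) x : 0 <= a -> normS A (a%:C *: x) = a * normS A x.
Proof.
move=> a0; rewrite !normSE rformZl rformZr mulrA -expr2 sqrtrM ?sqr_ge0 //.
by rewrite sqrtr_sqr ger0_norm.
Qed.

Lemma normSN x : normS A (- x) = normS A x.
Proof. by rewrite !normSE rformNl rformNr opprK. Qed.

End Semidefinite.
End RealForm.

(** * Contraction of a fixed-length preconditioned step, and the bound on the update *)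

Section Contraction.
Variable R : realType.
Local Notation C := R[i].

(** A row eigenvector [v] of the first product yields [v *m X] for the second; it is nonzero, since
    otherwise [a *: v = 0]. *)
Lemma eigenvalue_mulC (F : fieldType) m n (X : 'M[F]_(m, n)) (Y : 'M_(n, m)) a :
  a != 0 -> eigenvalue (X *m Y) a -> eigenvalue (Y *m X) a.
Proof.
move=> a0 /eigenvalueP[v vE v0]; apply/eigenvalueP; exists (v *m X).
  by rewrite mulmxA -(mulmxA v) vE scalemxAl.
apply: contraNneq v0 => vX; have := vE; rewrite mulmxA vX mul0mx.
by move/esym/eqP; rewrite scaler_eq0 (negPf a0).
Qed.

Lemma hpdmx_unit n (A : 'M[C]_n) : hpdmx A -> A \in unitmx.
Proof.
move=> [_ pos]; rewrite unitmxE unitfE; apply/negP => /det0P[v v0 vA].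
have x0 : v^t* != 0.
  by apply: contraNneq v0 => v0; rewrite -[v]trmxCK v0 trmx0 map_mx0.
by have := pos _ x0; rewrite trmxCK vA mul0mx mxE ltxx.
Qed.

Lemma hpdmx_sqrt n (A : 'M[C]_n) : hpdmx A ->
  exists L : 'M[C]_n, [/\ L^t* = L, L *m L = A & L \in unitmx].
Proof.
move=> hA; have hL := sqrtmx_hpd hA; exists (sqrtmx A); split.
- exact/hermsymmxP/hL.1.
- exact: sqrtmxK.
- exact: hpdmx_unit.
Qed.

Lemma psdform_congr n p (A : 'M[C]_n) (T : 'M[C]_(n, p)) :
  psdform A -> psdform (T^t* *m A *m T).
Proof.
move=> [/hermsymmxP herm ge0]; split.
  by apply/hermsymmxP; rewrite !adjmxM trmxCK herm mulmxA.
by move=> x; rewrite -rformM.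
Qed.

(** The last conjunct lets bounds known for eigenvalues be applied to the diagonal entries [d]. *)
Lemma psd_spectral n (B : 'M[C]_n) : psdform B ->
  exists (Q : 'M[C]_n) (d : 'I_n -> R),
    [/\ Q *m Q^t* = 1%:M, B = Q^t* *m diag_mx (\row_j (d j)%:C) *m Q,
        forall j, 0 <= d j & forall j, eigenvalue B (d j)%:C].
Proof.
move=> [herm ge0]; have := hermitian_spectral_diag_real herm.
have := spectral_unitarymx B; have := orthomx_spectralP (hermitian_normalmx herm).
move: (spectralmx B) (spectral_diag B) => Q D BE Qu Dr.
rewrite invmx_unitary // in BE; have QQ := unitarymxP Qu.
have DE : D = \row_j (complex.Re (D 0 j))%:C.
  by apply/rowP => j; rewrite mxE RRe_real //; apply: (mxOverP Dr).
rewrite DE in BE; exists Q, (fun j => complex.Re (D 0 j)); split=> // j.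
- have := ge0 (Q^t* *m delta_mx j 0); rewrite rformM trmxCK BE.
  rewrite !mulmxA QQ mul1mx -mulmxA QQ mulmx1 rform_diag (bigD1 j) //=.
  rewrite big1 => [|l lj]; last by rewrite mxE (negPf lj) normsq0 mulr0.
  by rewrite mxE !eqxx normsq1 mulr1 addr0.
- apply/eigenvalueP; exists (delta_mx 0 j *m Q).
    rewrite [in LHS]BE !mulmxA -(mulmxA _ Q) QQ mulmx1 scalemxAl; congr (_ *m _).
    apply/rowP => l; rewrite mul_mx_diag !mxE eqxx andTb.
    by case: (eqVneq l j) => [->|_]; rewrite ?mulr0 ?mulr1 ?mul0r ?mul1r.
  apply/eqP => /(congr1 (mulmxr (Q^t*))); rewrite /= mul0mx -mulmxA QQ mulmx1.
  by move/rowP/(_ j)/eqP; rewrite !mxE !eqxx oner_eq0.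
Qed.

Section Step.
Variables (n : nat) (A k : 'M[C]_n) (Gam gam : R).
Hypotheses (hA : psdform A) (hk : hpdmx k).
Hypothesis spec : forall b : R, 0 < b -> eigenvalue (k *m A) b%:C -> gam <= b <= Gam.
Hypotheses (gam0 : 0 < gam) (gamG : gam <= Gam).
Let tau := 2 / (Gam + gam).
Let Delta := (Gam - gam) / (Gam + gam).

Let sum_gt0 : 0 < Gam + gam.
Proof. by rewrite addr_gt0 // (lt_le_trans gam0). Qed.

Lemma contraction_factor_ge0 : 0 <= Delta.
Proof. by rewrite divr_ge0 ?subr_ge0 // ltW. Qed.

Lemma step_length_ge0 : 0 <= tau.
Proof. by rewrite divr_ge0 // ltW. Qed.

(* With k = L ^ 2, the map 1 - tau k A is conjugate to 1 - tau L A L, and the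
   A-norm turns into the seminorm of L A L. *)
Lemma normS_contraction (c : 'cV[C]_n) :
  normS A (c - tau%:C *: (k *m (A *m c))) <= Delta * normS A c.
Proof.
have [L [LH LL Lu]] := hpdmx_sqrt hk.
pose B := L *m A *m L.
have hB : psdform B by rewrite /B -{1}LH; apply: psdform_congr.
have [Q [d [QQ BE d0 dE]]] := psd_spectral hB.
(* A positive eigenvalue of L A L is one of L L A = k A, hence lies in the spectral interval. Zero
   eigenvalues escape it, but carry weight zero in the seminorm. *)
have dbd j : d j = 0 \/ gam <= d j <= Gam.
  have := d0 j; rewrite le_eqVlt => /orP[/eqP|dj]; [by left|right].
  apply: spec => //; rewrite -LL -mulmxA; apply: eigenvalue_mulC.
    by rewrite eq_complex /= eqxx andbT gt_eqF.
  exact: dE.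
have [e ->] : exists e, c = L *m e by exists (invmx L *m c); rewrite mulKVmx.
have -> : L *m e - tau%:C *: (k *m (A *m (L *m e))) =
          L *m (e - tau%:C *: (B *m e)).
  by rewrite mulmxBr -scalemxAr /B -LL !mulmxA.
have FA f : rform A (L *m f) (L *m f) =
            \sum_j d j * normsq ((Q *m f) j 0).
  by rewrite rformM LH -/B BE -rformM rform_diag.
rewrite -ler_sqr ?nnegrE ?(mulr_ge0 contraction_factor_ge0) ?normS_ge0 //.
rewrite exprMn !sqr_normS // !FA.
rewrite mulr_sumr; apply: ler_sum => j _.
have QE t : (Q *m (e - t%:C *: (B *m e))) j 0 = (1 - t * d j)%:C * (Q *m e) j 0.
  rewrite mulmxBr -scalemxAr BE !mulmxA QQ mul1mx -mulmxA mul_diag_mx !mxE.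
  by rewrite rmorphB rmorphM rmorph1 mulrBl mul1r -mulrA.
rewrite QE normsqZ; move: (normsq_ge0 ((Q *m e) j 0)); move: (normsq _) => w w0.
rewrite mulrCA.
case: (dbd j) => [->|/andP[g1 g2]]; first by rewrite !mul0r !mulr0.
apply: ler_wpM2r; first by rewrite mulr_ge0.
have G0 : Gam + gam != 0 by rewrite gt_eqF.
(* It remains to bound |1 - tau d j| by [Delta]. The affine map t -> 1 - tau t takes the values
   [Delta] at [gam] and [- Delta] at [Gam], which is what fixes [tau]. *)
rewrite -(real_normK (num_real (1 - _))) ler_sqr ?nnegrE ?contraction_factor_ge0 //.
rewrite ler_norml.
rewrite -subr_ge0 -[X in _ && X]subr_ge0.
have -> : 1 - tau * d j - - Delta = 2 * (Gam - d j) / (Gam + gam).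
  by rewrite /tau /Delta; field.
have -> : Delta - (1 - tau * d j) = 2 * (d j - gam) / (Gam + gam).
  by rewrite /tau /Delta; field.
by rewrite !mulr_ge0 ?subr_ge0 // invr_ge0 ltW.
Qed.

End Step.

Section Update.
Variables (n : nat) (A k : 'M[C]_n) (tau Delta : R).
Variables (theta delta : R) (c : 'cV[C]_n).
Hypotheses (hA : psdform A) (hk : k \is hermsymmx).
Hypotheses (tau_ge0 : 0 <= tau) (Delta_ge0 : 0 <= Delta).
Hypothesis contr : normS A (c - tau%:C *: (k *m (A *m c))) <= Delta * normS A c.
Hypothesis htheta : forall y, rform A (k *m y) (k *m y) <= theta * rform 1%:M y y.
Hypothesis hdelta : forall y, normS 1%:M (k *m y) <= delta * normS 1%:M y.
Hypothesis c1 : rform 1%:M c c = 1.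
Let eps := rform A c c.
Let s := Num.sqrt (theta * eps).
Let d := c - tau%:C *: (k *m (A *m c - eps%:C *: c)).
Hypothesis small : tau * (s + delta * eps) < 1.

Lemma psd_update_bound :
  rform A d d <= ((Delta + tau * s) / (1 - tau * (s + delta * eps))) ^+ 2
                 * eps * rform 1%:M d d.
Proof.
have p1 := psdform1 R n.
have eps0 : 0 <= eps := hA.2 c.
have nc : normS 1%:M c = 1 by rewrite normSE c1 sqrtr1.
have th0 : 0 <= theta by have := htheta c; rewrite c1 mulr1; apply: le_trans; apply: hA.2.
have sE : s = Num.sqrt theta * Num.sqrt eps by rewrite /s sqrtrM.
have nkA y : normS A (k *m y) <= Num.sqrt theta * normS 1%:M y.
  by rewrite !normSE -sqrtrM // ler_wsqrtr.
have dE : d = (c - tau%:C *: (k *m (A *m c))) + (tau * eps)%:C *: (k *m c).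
  rewrite /d mulmxBr -scalemxAr scalerBr opprB scalerA (rmorphM _ tau eps).
  by rewrite -addrA [in RHS](addrC (- _)).
have /hermsymmxP kH := hk.
(* For y = k A c, Hermitian [k] gives |y|^2 = <k y, c>_A. Cauchy-Schwarz bounds this by sqrt(theta)
   |y| sqrt(eps) = s |y|, and |y| cancels. *)
have kAc : normS 1%:M (k *m (A *m c)) <= s.
  set y := k *m (A *m c).
  have : normS 1%:M y ^+ 2 <= s * normS 1%:M y.
    rewrite sqr_normS //.
    have -> : rform 1%:M y y = rform A (k *m y) c.
      by rewrite {2}/y rformMl kH mulmxA /rform !mulmxA mulmx1.
    apply: le_trans (cauchy_schwarz hA _ _) _.
    by rewrite sE mulrAC; apply: ler_wpM2r; rewrite ?sqrtr_ge0.
  have := normS_ge0 1%:M y; rewrite le_eqVlt => /orP[/eqP <- _|y0].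
    exact: sqrtr_ge0.
  by rewrite expr2 ler_pM2r.
have normA : normS A d <= (Delta + tau * s) * Num.sqrt eps.
  rewrite dE; apply: le_trans (normSD hA _ _) _; rewrite mulrDl lerD //.
  rewrite normSZ ?mulr_ge0 //.
  apply: (@le_trans _ _ (tau * eps * Num.sqrt theta)).
    by apply: ler_wpM2l; rewrite ?mulr_ge0 //; have := nkA c; rewrite nc mulr1.
  by rewrite sE -!mulrA ler_wpM2l // -expr2 sqr_sqrtr // mulrC.
clear dE.
(* Reverse triangle inequality, from |c| = 1 and the bounds on k A c and k c. *)
have norm1 : 1 - tau * (s + delta * eps) <= normS 1%:M d.
  rewrite lerBlDr -[X in X <= _]nc.
  have -> : c = d + tau%:C *: (k *m (A *m c) + eps%:C *: - (k *m c)).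
    by rewrite /d mulmxBr -scalemxAr scalerN subrK.
  apply: le_trans (normSD p1 _ _) _; rewrite lerD2l normSZ // ler_wpM2l //.
  apply: le_trans (normSD p1 _ _) _; rewrite lerD // normSZ // normSN mulrC.
  by rewrite ler_wpM2r //; have := hdelta c; rewrite nc mulr1.
set D := 1 - _ in norm1 *; have D0 : 0 < D by rewrite subr_gt0.
rewrite -!sqr_normS // -[eps in X in _ <= X]sqr_sqrtr // -!exprMn ler_sqr.
- apply: le_trans normA _; rewrite mulrAC ler_wpM2r ?sqrtr_ge0 //.
  rewrite mulrAC -[X in X <= _]mulr1 -mulrA ler_wpM2l //.
    by rewrite addr_ge0 ?mulr_ge0 ?sqrtr_ge0.
  by rewrite ler_pdivlMr ?mul1r.
- by rewrite nnegrE sqrtr_ge0.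
- by rewrite nnegrE !mulr_ge0 ?addr_ge0 ?mulr_ge0 ?sqrtr_ge0 // invr_ge0 ltW.
Qed.

End Update.

End Contraction.

(** * The spectral norm as an operator bound *)

Section SpectralNorm.
Variable R : realType.
Local Notation C := R[i].

(** The sum of the [d j] is the trace of A^H A, so this is the Frobenius bound. It is crude, but
    shows that the set defining [specnorm] is bounded above. *)
Lemma mulmx_bounded m n (A : 'M[C]_(m, n)) :
  exists2 b : R, 0 <= b & forall x, normS 1%:M (A *m x) <= b * normS 1%:M x.
Proof.
have [Q [d [QQ AE d0 _]]] := psd_spectral (psdform_congr A (psdform1 R m)).
exists (Num.sqrt (\sum_j d j)) => [|x]; first exact: sqrtr_ge0.
have D0 : 0 <= \sum_j d j by apply: sumr_ge0.
rewrite !normSE -sqrtrM // ler_wsqrtr // rformM AE -rformM rform_diag.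
have -> : rform 1%:M x x = rform 1%:M (Q *m x) (Q *m x).
  by rewrite rformM mulmx1 (mulmx1C QQ).
rewrite rform1 mulr_suml; apply: ler_sum => j _; apply: ler_wpM2l => //.
by rewrite (bigD1 j) //= lerDl sumr_ge0 // => *; apply: normsq_ge0.
Qed.

Lemma specnormP m n (A : 'M[C]_(m, n)) x :
  normS 1%:M (A *m x) <= specnorm A * normS 1%:M x.
Proof.
have [b b0 Ab] := mulmx_bounded A.
have nx := normS_ge0 1%:M x.
(* A vector of norm zero cannot be normalized; the crude bound settles it. *)
have [x0|x0] := eqVneq (normS 1%:M x) 0.
  by have := Ab x; rewrite x0 !mulr0.
have xp : 0 < normS 1%:M x by rewrite lt_def x0.
rewrite -ler_pdivrMr // mulrC -normSZ ?invr_ge0 // scalemxAr.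
apply: ub_le_sup.
  exists b => _ [y /= y1 <-]; apply: le_trans (Ab y) _.
  by rewrite -[leRHS]mulr1 ler_wpM2l.
exists ((normS 1%:M x)^-1%:C *: x) => //=.
by rewrite normSZ ?invr_ge0 // mulVf.
Qed.

Lemma rform_specnorm n (A : 'M[C]_n) x y :
  rform 1%:M x (A *m y) <= specnorm A * (normS 1%:M x * normS 1%:M y).
Proof.
apply: le_trans (cauchy_schwarz (psdform1 R n) _ _) _.
by rewrite mulrCA ler_wpM2l ?normS_ge0 // specnormP.
Qed.

End SpectralNorm.

(** * The upper-bound half of the Courant-Fischer principle *)

Section CourantFischer.
Variable R : realType.
Local Notation C := R[i].

Lemma eigensystem_diag n (A B : 'M[C]_n) l (W : 'M[C]_n) :
  eigensystem A B l W -> W^t* *m A *m W = diag_mx (\row_j (l j)%:C).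
Proof.
move=> [AW WBW _].
have -> : W^t* *m A *m W = W^t* *m B *m W *m diag_mx (\row_j (l j)%:C).
  rewrite -!mulmxA; congr (_ *m _); apply/matrixP => a b.
  have /matrixP/(_ a 0) := AW b; rewrite !colE !mulmxA -!colE.
  by move: (A *m W) (B *m W) => X Y; rewrite mul_mx_diag !mxE mulrC.
by rewrite WBW mul1mx.
Qed.

Lemma exists_kernel_vector (F : fieldType) q (G : 'M[F]_(q, q + 1)) :
  exists2 x : 'cV[F]_(q + 1), x != 0 & G *m x = 0.
Proof.
have K0 : kermx G^T != 0.
  rewrite kermx_eq0 /row_free neq_ltn (leq_ltn_trans (rank_leq_col _)) //.
  by rewrite addn1.
exists (nz_row (kermx G^T))^T; first by rewrite -trmx0 (inj_eq trmx_inj) nz_row_eq0.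
apply: trmx_inj; rewrite trmx_mul trmxK trmx0.
by apply/sub_kermxP; apply: nz_row_sub.
Qed.

(** The left inverse [Y'] makes the range of [Y] have dimension q + 1, so it contains a nonzero
    vector B-orthogonal to the first q eigenvectors. If [mu < l k], the form of A - mu B would be
    positive there. As [k] counts from 0, exactly q eigenvectors precede it. *)
Lemma courant_fischer_le n (A B : 'M[C]_n) l (W : 'M[C]_n) (k : 'I_n) q mu
    (Y : 'M[C]_(n, q + 1)) (Y' : 'M[C]_(q + 1, n)) :
  eigensystem A B l W -> k = q :> nat -> Y' *m Y = 1%:M ->
  (forall x, rform (A - mu%:C *: B) (Y *m x) (Y *m x) <= 0) -> l k <= mu.
Proof.
move=> eigW kq YY Yle0; have [_ WBW lmono] := eigW.
have WWB : W *m (W^t* *m B) = 1%:M := mulmx1C WBW.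
have qn : (q <= n)%N by rewrite -kq ltnW.
have [x x0 Gx] := exists_kernel_vector
  (rowsub (widen_ord qn) (W^t* *m B *m Y)).
rewrite leNgt; apply/negP => mul.
(* Coordinates of [Y *m x] in the eigenbasis; those before [k] vanish by the choice of [x]. *)
pose s := W^t* *m B *m (Y *m x).
have Ws : W *m s = Y *m x by rewrite /s mulmxA WWB mul1mx.
have := Yle0 x; rewrite -Ws rformM mulmxBr mulmxBl -scalemxAr -scalemxAl WBW.
rewrite (eigensystem_diag eigW).
have -> : diag_mx (\row_j (l j)%:C) - mu%:C *: 1%:M =
          diag_mx (\row_j (l j - mu)%:C) :> 'M[C]_n.
  apply/matrixP => a b; rewrite !mxE rmorphB mulrnBl.
  by case: eqP => _; rewrite ?mulr1n ?mulr0n ?mulr1 ?mulr0.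
rewrite rform_diag; apply/negP; rewrite -ltNge.
have s_small (j : 'I_n) : (j < k)%N -> s j 0 = 0.
  rewrite kq => jq; move/matrixP/(_ (Ordinal jq) 0): Gx.
  rewrite mul_rowsub_mx -(mulmxA _ Y) -/s [rowsub _ _ _ _]mxE [(0 : matrix _ _ _) _ _]mxE.
  by move=> <-; congr (s _ _); apply: val_inj.
have s0 : s != 0.
  apply: contraNneq x0 => s0.
  by rewrite -[x]mul1mx -YY -mulmxA -Ws s0 !mulmx0.
have [j sj] : exists j, s j 0 != 0.
  by case/matrix0Pn: s0 => j [o]; rewrite ord1; exists j.
have lgt (o : 'I_n) : (k <= o)%N -> 0 < l o - mu.
  by move=> ko; rewrite subr_gt0 (lt_le_trans mul) ?lmono.
rewrite (bigD1 j) //= ltr_pwDl //.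
  rewrite mulr_gt0 ?normsq_gt0 ?lgt // leqNgt.
  by apply: contraNN sj => /s_small ->.
apply: sumr_ge0 => o _; have [ok|ko] := ltnP o k.
  by rewrite s_small // normsq0 mulr0.
by rewrite mulr_ge0 ?normsq_ge0 // ltW ?lgt.
Qed.

End CourantFischer.

(** * Deflated and trailing columns of the eigenvector matrix *)

Section DeflationFacts.
Variables (R : realType) (n : nat).
Local Notation C := R[i].

(** Reduces every block relation between head and tail columns to reading entries of U^H S U = I or
    of the diagonal matrix U^H H U. *)
Lemma adj_colsub m p q (f : 'I_p -> 'I_n) (g : 'I_q -> 'I_n) (A : 'M[C]_m)
    (U : 'M[C]_(m, n)) :
  (colsub f U)^t* *m A *m colsub g U = mxsub f g (U^t* *m A *m U).
Proof.
apply/matrixP => a b; rewrite [RHS]mxE ![in LHS]mxE [in RHS]mxE.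
apply: eq_bigr => j _; rewrite [colsub _ _ _ _]mxE; congr (_ * _).
by rewrite !mxE; apply: eq_bigr => o _; rewrite !mxE.
Qed.

Lemma split_columns (U : 'M[C]_n) (i : 'I_n) :
  U *m U^t* = headcols U i *m (headcols U i)^t* + tailcols U i *m (tailcols U i)^t*.
Proof.
have E : (i + (n - i))%N = n by rewrite subnKC // ltnW.
apply/matrixP => a b; rewrite !mxE.
rewrite (reindex (cast_ord E)) /=; last first.
  by exists (cast_ord (esym E)) => j _; rewrite ?cast_ordK ?cast_ordKV.
rewrite big_split_ord; congr (_ + _); apply: eq_bigr => j _; rewrite !mxE.
  by congr (U _ _ * (U _ _)^*); apply: val_inj.
by congr (U _ _ * (U _ _)^*); apply: val_inj.
Qed.

End DeflationFacts.

(* Stated over an abstract ring because [mulmxA] takes minutes to normalize such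
   a product over R[i], where unification unfolds the scalars. *)
Lemma mulmx_regroup (F : pzSemiRingType) n p (S K Q : 'M[F]_n) (T : 'M_(n, p))
    (A : 'M_p) (T' : 'M_(p, n)) :
  T' *m Q *m (Q *m K *m (S *m T *m A *m T' *m S) *m K *m Q *m (Q *m T)) =
  T' *m (Q *m Q) *m K *m S *m T *m A *m (T' *m S *m K *m (Q *m Q) *m T).
Proof. by rewrite !mulmxA. Qed.

(** * One deflated step in eigenvector coordinates *)

Section DeflatedStep.
Variables (R : realType) (n m p : nat).
Local Notation C := R[i].
Variables (H S K : 'M[C]_n) (V : 'M[C]_(n, m)) (T : 'M[C]_(n, p)).
Variables (lamV : 'I_m -> R) (lamT : 'I_p -> R) (lam0 : R).
Hypotheses (hH : H \is hermsymmx) (hS : hpdmx S) (hK : K \is hermsymmx).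
Hypothesis VTI : V *m V^t* *m S + T *m T^t* *m S = 1%:M.
Hypotheses (VSV : V^t* *m S *m V = 1%:M) (TST : T^t* *m S *m T = 1%:M).
Hypotheses (VST : V^t* *m S *m T = 0) (VHT : V^t* *m H *m T = 0).
Hypothesis VHV : V^t* *m H *m V = diag_mx (\row_a (lamV a)%:C).
Hypothesis THT : T^t* *m H *m T = diag_mx (\row_b (lamT b)%:C).
Hypotheses (lamV_le : forall a, lamV a <= lam0) (lamT_ge : forall b, lam0 <= lamT b).

(* Variables with equations rather than local definitions, which unification
   would unfold. *)
Variables (k A : 'M[C]_p) (P M Q : 'M[C]_n).
Hypothesis kdef : k = T^t* *m S *m K *m S *m T.
Hypothesis Adef : A = T^t* *m (H - lam0%:C *: S) *m T.
Hypothesis Pdef : P = 1%:M - V *m V^t* *m S.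
Hypothesis Mdef : M = P^t* *m (H - lam0%:C *: S) *m P.
Hypothesis Qdef : Q = sqrtmx S.

Let HE : H^t* = H. Proof. exact/hermsymmxP. Qed.
Let SE : S^t* = S. Proof. exact/hermsymmxP/hS.1. Qed.
Let KE : K^t* = K. Proof. exact/hermsymmxP. Qed.
Let QE : Q^t* = Q. Proof. by rewrite Qdef; exact/hermsymmxP/(sqrtmx_hpd hS).1. Qed.
Let QQ : Q *m Q = S. Proof. by rewrite Qdef; apply: sqrtmxK. Qed.

Lemma deflation_projector : P = T *m T^t* *m S.
Proof. by rewrite Pdef -VTI addrAC subrr add0r. Qed.

Lemma deflated_shift : M = S *m T *m A *m T^t* *m S.
Proof. by rewrite Mdef deflation_projector !adjmxM trmxCK SE Adef !mulmxA. Qed.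

Lemma tail_pencil mu : V^t* *m (H - mu%:C *: S) *m T = 0.
Proof. by rewrite mulmxBr mulmxBl -scalemxAr -scalemxAl VHT VST scaler0 subr0. Qed.

(** The range of [T] is a deflating subspace of the pencil: expanding along S V V^H + S T T^H = I,
    the [V] part vanishes by [tail_pencil]. *)
Lemma shift_tail : (H - lam0%:C *: S) *m T = S *m T *m A.
Proof.
have SVTI : S *m V *m V^t* + S *m T *m T^t* = 1%:M.
  have := congr1 (fun X : 'M_(_, _) => X^t*) VTI.
  by rewrite adjmxD !adjmxM !trmxCK SE adjmx1 !mulmxA.
rewrite -[LHS]mul1mx -SVTI mulmxDl -(mulmxA _ (V^t*)) (mulmxA (V^t*)) tail_pencil.
by rewrite mulmx0 add0r Adef !mulmxA.
Qed.

Lemma diag_mx_sub q (d : 'I_q -> R) mu :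
  diag_mx (\row_b (d b)%:C) - mu%:C *: 1%:M = diag_mx (\row_b (d b - mu)%:C) :> 'M[C]_q.
Proof.
apply/matrixP => a b; rewrite !mxE rmorphB mulrnBl.
by case: eqP => _; rewrite ?mulr1n ?mulr0n ?mulr1 ?mulr0.
Qed.

Lemma tail_form : A = diag_mx (\row_b (lamT b - lam0)%:C).
Proof. by rewrite Adef mulmxBr mulmxBl -scalemxAr -scalemxAl TST THT diag_mx_sub. Qed.

Lemma tail_form_psd : psdform A.
Proof.
split=> [|x]; last first.
  rewrite tail_form rform_diag sumr_ge0 // => b _.
  by rewrite mulr_ge0 ?normsq_ge0 // subr_ge0 lamT_ge.
by apply/hermsymmxP; rewrite Adef !adjmxM trmxCK adjmxD adjmxN adjmxZ HE SE mulmxA.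
Qed.

(** K M = (K S T A)(T^H S), and the same factors in reverse order multiply to k A. This transfers
    the extremal property of [Gam] and [gam] to the block. *)
Lemma deflated_eigenvalue (b : R) :
  0 < b -> eigenvalue (k *m A) b%:C -> eigenvalue (K *m M) b%:C.
Proof.
move=> b0 kAb; rewrite deflated_shift.
have -> : K *m (S *m T *m A *m T^t* *m S) = K *m S *m T *m A *m (T^t* *m S).
  by rewrite !mulmxA.
apply: eigenvalue_mulC; first by rewrite eq_complex /= eqxx andbT gt_eqF.
by move: kAb; rewrite kdef !mulmxA.
Qed.

(** Q T is an isometry, since (Q T)^H Q T = T^H S T = I; block quantities are thus compressions of
    the full matrices in the spectral norms. *)
Let norm_tail y : normS 1%:M (Q *m (T *m y)) = normS 1%:M y.
Proof.
rewrite mulmxA !normSE rformM mulmx1 adjmxM QE.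
by rewrite -mulmxA (mulmxA Q) QQ mulmxA TST.
Qed.

(** k A k is the compression of Q K M K Q by the isometry Q T. *)
Lemma theta_bound y :
  rform A (k *m y) (k *m y) <=
  specnorm (Q *m K *m M *m K *m Q) * rform 1%:M y y.
Proof.
have kE : k^t* = k by rewrite kdef !adjmxM trmxCK KE SE !mulmxA.
rewrite -(sqr_normS (psdform1 R p)).
rewrite expr2 -{1}norm_tail -{1}[normS _ y]norm_tail.
apply: le_trans (rform_specnorm _ _ _); rewrite le_eqVlt; apply/orP; left.
apply/eqP; rewrite [LHS]rformM kE !(mulmxA Q T) (mulmxA _ (Q *m T)) [RHS]rformM.
rewrite mulmx1 adjmxM QE deflated_shift; congr (rform _ y y).
by rewrite mulmx_regroup QQ kdef.
Qed.

(** k is the compression of Q K Q by Q T. The form bound becomes a norm bound by testing against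
    [k *m y] and cancelling its norm. *)
Lemma delta_bound y :
  normS 1%:M (k *m y) <= specnorm (Q *m K *m Q) * normS 1%:M y.
Proof.
have p1 := psdform1 R p.
have [y0|y0] := eqVneq (normS 1%:M (k *m y)) 0.
  by rewrite y0 -[normS _ y]norm_tail; apply: le_trans (specnormP _ _); apply: normS_ge0.
have yp : 0 < normS 1%:M (k *m y) by rewrite lt_def y0 normS_ge0.
rewrite -(ler_pM2l yp) -expr2 sqr_normS // mulrCA -{1}norm_tail -{1}[normS _ y]norm_tail.
apply: le_trans (rform_specnorm _ _ _); rewrite le_eqVlt; apply/orP; left.
apply/eqP; rewrite [LHS]rformMr mul1mx !(mulmxA Q T) (mulmxA _ (Q *m T)) [RHS]rformM.
rewrite mulmx1 adjmxM QE; congr (rform _ (k *m y) y).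
have -> : T^t* *m Q *m (Q *m K *m Q *m (Q *m T)) =
  T^t* *m (Q *m Q) *m K *m (Q *m Q) *m T.
  by rewrite !mulmxA.
by rewrite QQ.
Qed.

Variables (u : 'cV[C]_n) (l : R).
Hypotheses (VSu : V^t* *m S *m u = 0) (nu : normS S u = 1).
Hypothesis lE : l%:C = rayleigh H S u.
Variables (c : 'cV[C]_p) (eps : R).
Hypotheses (cdef : c = T^t* *m S *m u) (epsdef : eps = l - lam0).

Lemma iterate_coords : u = T *m c.
Proof.
rewrite -[LHS]mul1mx -VTI mulmxDl -(mulmxA V) -(mulmxA V) VSu mulmx0 add0r.
by rewrite cdef !mulmxA.
Qed.

Let rSu : rform S u u = 1.
Proof.
(* [Num.sqrt] is 0 on negative numbers, so norm 1 excludes a negative form. *)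
have pu : 0 <= rform S u u.
  rewrite leNgt; apply/negP => /ltW /ler0_sqrtr s0.
  by have := nu; rewrite normSE s0 => /esym/eqP; rewrite oner_eq0.
by rewrite -[LHS]sqr_sqrtr // -normSE nu expr1n.
Qed.

Lemma coords_norm : rform 1%:M c c = 1.
Proof. by rewrite -rSu iterate_coords rformM TST. Qed.

Lemma coords_energy : rform A c c = eps.
Proof.
rewrite Adef -rformM -iterate_coords rform_addmx rform_oppmx rform_scalemx rSu mulr1.
rewrite epsdef; congr (_ - _); rewrite -[RHS]mulr1 -rSu /rform -ReZ lE /rayleigh divfK //.
by apply/eqP => s0; move: rSu; rewrite /rform s0 => /esym/eqP; rewrite oner_eq0.
Qed.

Variable pr : 'cV[C]_n.
Hypothesis prdef : pr = - (K *m (H *m u - l%:C *: (S *m u))).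

(** Shifting by [lam0] writes the residual as (H - lam0 S) u - eps S u, which [shift_tail] turns
    into S T (A c - eps c). *)
Lemma residual_coords : T^t* *m S *m pr = - (k *m (A *m c - eps%:C *: c)).
Proof.
have -> : pr = - (K *m (S *m (T *m (A *m c - eps%:C *: c)))).
  rewrite prdef; congr (- (K *m _)).
  have -> : H *m u - l%:C *: (S *m u) =
      (H - lam0%:C *: S) *m u - eps%:C *: (S *m u).
    by rewrite mulmxBl -scalemxAl epsdef rmorphB scalerBl opprB addrA subrK.
  by rewrite iterate_coords mulmxA shift_tail !mulmxBr -!scalemxAr !mulmxA.
by rewrite mulmxN kdef !mulmxA.
Qed.

(** The trial space is spanned by [V] and [T *m d]. The form of H - mu S has no cross term between
    them; it is nonpositive on [V] because lamV <= lam0 <= mu, and on [T *m d] by the last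
    hypothesis. *)
Lemma ritz_bound tau mu g W lW :
  let Z := psd_basis H S V K l u in
  let d := c - tau%:C *: (k *m (A *m c - eps%:C *: c)) in
  eigensystem (Z^t* *m H *m Z) (Z^t* *m S *m Z) lW W ->
  g = lW (lshift 1 (rshift m (@ord0 0))) ->
  lam0 <= mu ->
  rform A d d <= (mu - lam0) * rform 1%:M d d -> g <= mu.
Proof.
move=> Z d eigW -> lmu dmu.
(* T d equals u + tau p with the [V] component of tau p removed, and [v] holds the coefficients of
   that removal. [Y] expresses [V, T d] in the basis [V u p]; [Y'] inverts its unit triangular upper
   block. *)
pose v := - (tau%:C *: (V^t* *m S *m pr)).
pose Y := col_mx (block_mx 1%:M v 0 1%:M) (row_mx 0 tau%:C%:M) : 'M[C]_(m + 1 + 1, m + 1).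
pose Y' := row_mx (block_mx 1%:M (- v) 0 1%:M) 0 : 'M[C]_(m + 1, m + 1 + 1).
have zE : T *m d = V *m v + u + pr *m tau%:C%:M.
  have -> : d = c + tau%:C *: (T^t* *m S *m pr).
    by rewrite residual_coords scalerN.
  rewrite mulmxDr -iterate_coords -scalemxAr mul_mx_scalar.
  rewrite -[X in _ = _ + tau%:C *: X]mul1mx -VTI mulmxDl scalerDr.
  rewrite /v mulmxN -scalemxAr !mulmxA [- _ + u]addrC -addrA; congr (_ + _).
  by rewrite addrA addNr add0r.
have ZY : Z *m Y = row_mx V (T *m d).
  rewrite /Z /psd_basis -prdef /Y mul_row_col mul_row_block mul_mx_row.
  by rewrite !mulmx1 !mulmx0 addr0 add_row_mx addr0 zE.
apply: (courant_fischer_le (q := m) (Y := Y) (Y' := Y') eigW) => /=.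
- by rewrite addn0.
- rewrite /Y' /Y mul_row_col mul0mx addr0 mulmx_block.
  by rewrite !mulmx0 !mul0mx !mulmx1 !mul1mx subrr !addr0 !add0r -scalar_mx_block.
move=> x.
have -> : Z^t* *m H *m Z - mu%:C *: (Z^t* *m S *m Z) = Z^t* *m (H - mu%:C *: S) *m Z.
  by rewrite mulmxBr mulmxBl -scalemxAr -scalemxAl.
rewrite -rformM mulmxA ZY -[x]vsubmxK mul_row_col.
set F := H - mu%:C *: S; set a := usubmx x; set b := dsubmx x.
have hF : F \is hermsymmx.
  by apply/hermsymmxP; rewrite /F adjmxD adjmxN adjmxZ HE SE.
have cross : rform F (V *m a) (T *m d *m b) = 0.
  have -> : rform F (V *m a) (T *m d *m b) =
      complex.Re ((a^t* *m (V^t* *m F *m T) *m d *m b) 0 0).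
    by rewrite /rform adjmxM !mulmxA.
  by rewrite tail_pencil mulmx0 !mul0mx mxE.
rewrite !(rformDl, rformDr) (rformC _ (V *m a) hF) cross addr0 add0r.
have -> : T *m d *m b = b 0 0 *: (T *m d).
  by rewrite {1}[b]mx11_scalar mul_mx_scalar.
rewrite rform_scale.
rewrite -[leRHS](addr0 0) lerD //.
  rewrite rformM mulmxBr mulmxBl -scalemxAr -scalemxAl VHV VSV diag_mx_sub.
  rewrite rform_diag sumr_le0 // => j _.
  by rewrite mulr_le0_ge0 ?normsq_ge0 // subr_le0 (le_trans (lamV_le j)).
rewrite mulr_ge0_le0 ?normsq_ge0 //.
have -> : F = (H - lam0%:C *: S) - (mu - lam0)%:C *: S.
  by rewrite rmorphB scalerBl /F opprB addrA subrK.
rewrite rform_addmx rform_oppmx rform_scalemx !rformM TST -Adef.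
by rewrite subr_le0.
Qed.

Lemma deflated_step_bound (Gam gam : R) W lW g :
  let Z := psd_basis H S V K l u in
  let theta := specnorm (Q *m K *m M *m K *m Q) in
  let delta := specnorm (Q *m K *m Q) in
  let Delta := (Gam - gam) / (Gam + gam) in
  let tau := 2 / (Gam + gam) in
  hpdmx k ->
  eigensystem (Z^t* *m H *m Z) (Z^t* *m S *m Z) lW W ->
  g = lW (lshift 1 (rshift m (@ord0 0))) ->
  max_pos_eigenvalue (K *m M) Gam -> min_pos_eigenvalue (K *m M) gam ->
  tau * (Num.sqrt (theta * eps) + delta * eps) < 1 ->
  g - lam0 <= ((Delta + tau * Num.sqrt (theta * eps))
                / (1 - tau * (Num.sqrt (theta * eps) + delta * eps))) ^+ 2 * eps.
Proof.
move=> Z theta delta Delta tau hk eigW gE [Gam0 _ Gamle] [gam0 gamev gamle].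
have gamG : gam <= Gam by apply: Gamle.
have spec b : 0 < b -> eigenvalue (k *m A) b%:C -> gam <= b <= Gam.
  by move=> b0 /(deflated_eigenvalue b0) kb; rewrite gamle // Gamle.
have contr := normS_contraction tail_form_psd hk spec gam0 gamG c.
have D0 : 0 <= Delta := contraction_factor_ge0 gam0 gamG.
have t0 : 0 <= tau := step_length_ge0 gam0 gamG.
rewrite -/Delta -/tau in contr; move: Delta tau D0 t0 contr => Delta tau D0 t0 contr.
have eps0 : 0 <= eps by rewrite -coords_energy; apply: tail_form_psd.2.
have := psd_update_bound tail_form_psd hk.1 t0 D0 contr theta_bound delta_bound
  coords_norm.
rewrite coords_energy lerBlDl => bound small.
(* Here [mu] is [lam0] plus the claimed bound, so that mu - lam0 is the Rayleigh quotient bound of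
   the update. *)
apply: (ritz_bound (tau := tau) eigW gE); first by rewrite lerDl mulr_ge0 ?sqr_ge0.
by rewrite addrAC subrr add0r; apply: bound.
Qed.

End DeflatedStep.

(** * The convergence bound, from the head and tail blocks of [U] *)

Theorem theorem3p2 (R : realType) (n : nat)
    (H S : 'M[R[i]]_n) (lam : 'I_n -> R) (U : 'M[R[i]]_n)
    (i : 'I_n) (K : 'M[R[i]]_n)
    (lamj : R) (uj : 'cV[R[i]]_n) (lamj1 : R) (uj1 : 'cV[R[i]]_n)
    (Gam gam : R) :
  let V := headcols U i in
  let P := 1%:M - V *m V^t* *m S in
  let M := P^t* *m (H - (lam i)%:C *: S) *m P in
  let eps := lamj - lam i in
  let eps1 := lamj1 - lam i in
  let theta := specnorm (sqrtmx S *m K *m M *m K *m sqrtmx S) in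
  let delta := specnorm (sqrtmx S *m K *m sqrtmx S) in
  let Delta := (Gam - gam) / (Gam + gam) in
  let tau := 2 / (Gam + gam) in
  H \is hermsymmx ->
  hpdmx S ->
  eigensystem H S lam U ->
  (i.+1 < n)%N ->
  (forall j : 'I_n, j.+1 = i -> lam j < lam i) ->
  (forall j : 'I_n, j = i.+1 :> nat -> lam i < lam j) ->
  K \is hermsymmx ->
  eff_posdef S U i K ->
  psd_id_step H S V K lamj uj lamj1 uj1 ->
  max_pos_eigenvalue (K *m M) Gam ->
  min_pos_eigenvalue (K *m M) gam ->
  tau * (Num.sqrt (theta * eps) + delta * eps) < 1 ->
  eps1 <= ((Delta + tau * Num.sqrt (theta * eps))
            / (1 - tau * (Num.sqrt (theta * eps) + delta * eps))) ^+ 2 * eps.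
Proof.
move=> V P M eps eps1 theta delta Delta tau hH hS eigU _ _ _ hK hk.
move=> [VSu nu lamjE _ [w [lW [W [eigW gE _]]] _]].
have [_ USU lmono] := eigU; have UHU := eigensystem_diag eigU.
pose head := widen_ord (ltnW (ltn_ord i)).
pose tail b := cast_ord (subnKC (ltnW (ltn_ord i))) (rshift i b).
have head_inj : injective head by move=> a b /(congr1 val) /= /val_inj.
have tail_inj : injective tail by move=> a b /cast_ord_inj /rshift_inj.
have headNtail a b : (head a == tail b) = false.
  by apply/eqP => /(congr1 val) /= ab; have := ltn_ord a; rewrite ab ltnNge leq_addr.
apply: (deflated_step_bound (T := tailcols U i) (lamV := lam \o head)
  (lamT := lam \o tail) hH hS hK _ _ _ _ _ _ _ _ _ (erefl _) (erefl _) (erefl _)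
  (erefl _) (erefl _) VSu nu lamjE (erefl _) (erefl _) (erefl _) hk eigW gE).
(* The two blocks recombine into U U^H S, which is I because U^H S is a left inverse of the square
   matrix [U]. *)
- by rewrite -mulmxDl -split_columns -mulmxA; apply: mulmx1C.
- rewrite adj_colsub USU; apply/matrixP => a b.
  by rewrite !mxE (inj_eq head_inj).
- rewrite adj_colsub USU; apply/matrixP => a b.
  by rewrite !mxE (inj_eq tail_inj).
- by rewrite adj_colsub USU; apply/matrixP => a b; rewrite !mxE headNtail.
- by rewrite adj_colsub UHU; apply/matrixP => a b; rewrite !mxE headNtail.
- rewrite adj_colsub UHU; apply/matrixP => a b.
  by rewrite !mxE (inj_eq head_inj).
- rewrite adj_colsub UHU; apply/matrixP => a b.
  by rewrite !mxE (inj_eq tail_inj).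
- by move=> a; apply: lmono; rewrite ltnW //= ltn_ord.
- by move=> b; apply: lmono; rewrite /= leq_addr.
Qed.
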